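(* Let $f$ be a probability density on $\mathbb R$, strictly positive on its domain $D\subset\mathbb R$, with cumulative distribution function $F$, and let $q(x,y)$ be a proposal, defined and positive for $x,y\in D$, such that $q(x,\cdot)$ is a probability density on $D$ for each fixed $x\in D$. The copula of the Metropolis-Hastings algorithm with proposal $q(x,y)$ and invariant density $f$ is given by $$C(u,v)=AC(u,v)+SC(u,v),\qquad (u,v)\in[0,1]^2,$$ where $$AC(u,v)=\int_{0}^{u}\int_{0}^{v}\frac{q(F^{-1}(t),F^{-1}(z))}{f(F^{-1}(z))}\,\alpha(F^{-1}(t),F^{-1}(z))\,dz\,dt,$$ $$SC(u,v)=\int_{0}^{\min\{u,v\}}\Big[1-\int_{0}^{1}\frac{q(F^{-1}(t),F^{-1}(z))}{f(F^{-1}(z))}\,\alpha(F^{-1}(t),F^{-1}(z))\,dz\Big]dt,$$ and $\alpha(x,y)=\min\left\{\frac{f(y)q(y,x)}{f(x)q(x,y)},1\right\}$.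
   Context: The Metropolis-Hastings algorithm with proposal $q$ and invariant density $f$ is the Markov chain on $D$ with transition kernel $$P(x,dy)=q(x,y)\alpha(x,y)\,dy+\Big(1-\int q(x,y)\alpha(x,y)\,dy\Big)\delta_x(dy),$$ where $\alpha(x,y)=\min\{\frac{f(y)q(y,x)}{f(x)q(x,y)},1\}$ and $\delta_x$ is the point mass at $x$. Here the chain is taken stationary, i.e. $X_0$ has density $f$. Its copula is the (unique) copula $C$ of $(X_0,X_1)$, i.e. the function on $[0,1]^2$, a joint distribution function with uniform marginals on $[0,1]$, such that $P(X_0\le x,X_1\le y)=C(F(x),F(y))$ for all $x,y$. $F^{-1}$ denotes the (quantile) inverse of $F$. *)

(* Defs.v *)
From HB Require Import structures.
From mathcomp Require Import all_boot all_order all_algebra.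
From mathcomp Require Import all_classical all_reals all_analysis.

Set Implicit Arguments.
Unset Strict Implicit.
Unset Printing Implicit Defensive.

Import Order.TTheory GRing.Theory Num.Theory.
Import numFieldNormedType.Exports.

Local Open Scope classical_set_scope.
Local Open Scope ring_scope.

Definition density_cdf (R : realType) (f : R -> R) (x : R) : R :=
  \int[lebesgue_measure]_(t in `]-oo, x]) f t.

(* For 0 < t < 1 this is the usual generalized inverse; at the end points [inf]
   may be taken over an unbounded or empty set, where it is 0 by convention. *)
Definition quantile (R : realType) (F : R -> R) (t : R) : R :=
  inf [set x | t <= F x].

Definition mh_accept (R : realType) (f : R -> R) (q : R -> R -> R) (x y : R) : R :=
  Num.min ((f y * q y x) / (f x * q x y)) 1.

(* A transition kernel for x in the state space D; q is used only on D * D. *)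
Definition mh_kernel (R : realType) (D : set R) (f : R -> R) (q : R -> R -> R)
    (x : R) (B : set R) : \bar R :=
  (\int[lebesgue_measure]_(y in B `&` D) (q x y * mh_accept f q x y)%:E
   + (1 - \int[lebesgue_measure]_(y in D) (q x y * mh_accept f q x y)%:E)
     * \d_x B)%E.

(* The second clause is the Markov property together with the transition
   kernel: P(X_{n+1} \in B | X_0, ..., X_n) = K(X_n, B), tested on the pi-system
   of cylinder events, which generates the sigma-algebra of the past. *)
Definition markov_chain (d : measure_display) (T : measurableType d)
    (R : realType) (P : probability T R) (init : set R -> \bar R)
    (K : R -> set R -> \bar R) (X : nat -> {RV P >-> R}) : Prop :=
  (forall A : set R, measurable A -> distribution P (X 0%N) A = init A) /\
  (forall (n : nat) (A : nat -> set R) (B : set R),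
     (forall k, measurable (A k)) -> measurable B ->
     P (\bigcap_(k in `I_n.+1) (X k @^-1` A k) `&` X n.+1 @^-1` B) =
     (\int[P]_(w in \bigcap_(k in `I_n.+1) (X k @^-1` A k)) K (X n w) B)%E).

Definition stationary_mh_chain (d : measure_display) (T : measurableType d)
    (R : realType) (P : probability T R) (D : set R) (f : R -> R)
    (q : R -> R -> R) (X : nat -> {RV P >-> R}) : Prop :=
  markov_chain (fun A => \int[lebesgue_measure]_(x in A) (f x)%:E)%E
    (mh_kernel D f q) X.

(* Copulas live on [0, 1]^2: the values of C elsewhere are not constrained. *)
Definition is_copula (R : realType) (C : R -> R -> R) : Prop :=
  exists m : probability (R * R)%type R,
    [/\ forall A : set R, measurable A ->
          m (A `*` setT) = uniform_prob (@ltr01 R) A,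
        forall A : set R, measurable A ->
          m (setT `*` A) = uniform_prob (@ltr01 R) A &
        forall u v : R, 0 <= u <= 1 -> 0 <= v <= 1 ->
          m (`]-oo, u] `*` `]-oo, v]) = (C u v)%:E].

Definition copula_of (d : measure_display) (T : measurableType d)
    (R : realType) (P : probability T R) (X Y : {RV P >-> R})
    (F G : R -> R) (C : R -> R -> R) : Prop :=
  is_copula C /\
  forall x y : R,
    P (X @^-1` `]-oo, x] `&` Y @^-1` `]-oo, y]) = (C (F x) (G y))%:E.

(* F^-1 may leave D on a Lebesgue-null set of levels.  When f vanishes outside D
   the convention a / 0 = 0 makes the integrand 0 there, so the values of q
   outside D * D are irrelevant. *)
Definition mh_copula_integrand (R : realType) (f : R -> R) (q : R -> R -> R)
    (t z : R) : R :=
  let Finv := quantile (density_cdf f) in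
  q (Finv t) (Finv z) / f (Finv z) * mh_accept f q (Finv t) (Finv z).

Definition mh_AC (R : realType) (f : R -> R) (q : R -> R -> R) (u v : R) : R :=
  \int[lebesgue_measure]_(t in `[0, u])
    \int[lebesgue_measure]_(z in `[0, v]) mh_copula_integrand f q t z.

Definition mh_SC (R : realType) (f : R -> R) (q : R -> R -> R) (u v : R) : R :=
  \int[lebesgue_measure]_(t in `[0, Num.min u v])
    (1 - \int[lebesgue_measure]_(z in `[0, 1]) mh_copula_integrand f q t z).

(* Main.v *)
Require Import Defs.
From HB Require Import structures.
From mathcomp Require Import all_boot all_order all_algebra.
From mathcomp Require Import all_classical all_reals all_analysis.
From mathcomp Require Import measurable_realfun.

Set Implicit Arguments.
Unset Strict Implicit.
Unset Printing Implicit Defensive.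

Import Order.TTheory GRing.Theory Num.Theory.
Import numFieldNormedType.Exports.

Local Open Scope classical_set_scope.
Local Open Scope ring_scope.

(** Let [nu] be the law of density [f], [F] its distribution function and [Q]
the quantile function.  Everything rests on inverse transform sampling: [Q]
carries the uniform law of the unit interval to [nu].  So the integral of
[h \o Q] from [0] to [v] is that of [h * f] over any set [A] such that, for
[0 < t < 1], [A (Q t)] means [t <= v] ([ge0_integral_quantile]).

The Metropolis-Hastings kernel moves from [x] with density [k x y] (the proposal
times the acceptance ratio), and with the remaining mass stays at [x].  Hence the
probability that [X_0] is in [A] and [X_1] in [B] is the integral over [A] of the
mass moved into [B], weighted by [f], plus the integral of the mass that stays
over the intersection of [A] and [B] ([integral_move_stay]).  Under the
substitution [x = Q t], [y = Q z] the first term becomes AC, where the quotient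
by [f (Q z)] pays for replacing [dy] by [dz], and the second becomes SC, where
the intersection is cut out by [t <= min u v] ([chain_joint_copula]).

Two choices of the sets are used.  Half-lines ending at [x] and [y], cut out at
[F x] and [F y], relate the joint distribution function to AC + SC.  The
sublevel sets of [F] at [u] and [v] show that AC + SC is, on the unit square, the
distribution function of [(F X_0, F X_1)].  Both coordinates of that pair are
uniform, because [F] has no jump ([law_density_cdf]) and because detailed balance
[f x * k x y = f y * k y x] gives [X_1] the law of [X_0]
([integral_move_stay_law]); so AC + SC is a copula.

Uniqueness: [F (Q t) = t] shows that [F] takes every value of the open interval,
so the joint law determines a copula on the open square, and its uniform margins
determine it on the boundary ([copula_margins]). *)

(** * Measurability of division *)

(** Real powers are known to be measurable, and [x^-1 = x * (x ^ 2)^-1] reduces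
the inverse to a power of a nonnegative number; the convention [0^-1 = 0] agrees
on both sides. *)
Lemma measurable_inv (R : realType) : measurable_fun setT (@GRing.inv R).
Proof.
rewrite (_ : GRing.inv = fun x : R => x * (x ^+ 2) `^ (-1)).
  apply: measurable_funM => //.
  by apply: (measurableT_comp (measurable_powR (-1))).
apply/funext => x; rewrite powR_inv1 ?sqr_ge0//.
by have [->|x0] := eqVneq x 0; rewrite ?invr0 ?mul0r// expr2 invfM mulVKf.
Qed.

Lemma measurable_fun_div d (T : measurableType d) (R : realType) (D : set T)
    (f g : T -> R) : measurable_fun D f -> measurable_fun D g ->
  measurable_fun D (fun x => f x / g x).
Proof.
move=> mf mg; apply: measurable_funM => //.
exact: (measurableT_comp (@measurable_inv R)).
Qed.

(** * The uniform distribution on the unit interval *)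

Section uniform01.
Variable R : realType.
Local Notation mu := lebesgue_measure.
Local Notation U := (uniform_prob (@ltr01 R)).

Lemma ge0_integral_uniform01 (A : set R) (h : R -> \bar R) : measurable A ->
    measurable_fun setT h -> (forall x, 0 <= h x)%E ->
  (\int[U]_(x in A) h x = \int[mu]_(x in `]0%R, 1%R[ `&` A) h x)%E.
Proof.
move=> mA mh h0.
have mhA : measurable_fun setT (h \_ A).
  by apply/(measurable_restrictT _ _).1 => //; exact: measurable_funTS.
rewrite integral_mkcond integral_uniform//; last first.
  by move=> x; rewrite erestrict_ge0.
rewrite subr0 invr1 mul1e integral_mkcondr.
by rewrite integral_itv_bndoo//; exact: measurable_funTS.
Qed.

(** The hypothesis on [B] is confined to the open interval because a quantile
function has no useful value at the end points, which are Lebesgue-null. *)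
Lemma integral_itv01_cut (B : set R) (v : R) (h : R -> \bar R) :
    measurable_fun (`]0, 1[ : set R) h -> 0 <= v <= 1 ->
    (forall t, 0 < t < 1 -> B t <-> t <= v) ->
  (\int[mu]_(x in `]0%R, 1%R[ `&` B) h x = \int[mu]_(x in `[0%R, v]) h x)%E.
Proof.
move=> mh /andP[v0 v1] Bv.
(* For v = 1 the right end point is missing, for v < 1 it is present. *)
have [b ->] : exists b, `]0, 1[ `&` B = [set` Interval (BRight 0) (BSide b v)].
  move: v1; rewrite le_eqVlt => /predU1P[v1|v1].
    exists true; apply/seteqP; split => [x []|x]; rewrite /= ?in_itv/= v1//
      => x01.
    by split => //; apply/(Bv _ x01); rewrite v1; case/andP: x01 => _ /ltW.
  exists false; apply/seteqP; split => [x []|x]; rewrite /= ?in_itv/=.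
    by move=> x01 /(Bv _ x01) ->; case/andP: x01 => ->.
  move=> /andP[x0 xv]; have x01 : 0 < x < 1 by rewrite x0 (le_lt_trans xv).
  by split => //; apply/(Bv _ x01).
have mhv : measurable_fun (`]0, v[ : set R) h.
  apply: measurable_funS mh => // x /=; rewrite !in_itv/= => /andP[->] /=.
  by move=> /lt_le_trans; exact.
by rewrite (integral_itv_bndoo false) // [RHS](integral_itv_bndoo true).
Qed.

Lemma uniform01_cut (B : set R) (v : R) : measurable B -> 0 <= v <= 1 ->
    (forall t, 0 < t < 1 -> B t <-> t <= v) -> U B = v%:E.
Proof.
move=> mB v01 Bv; transitivity (\int[U]_(x in B) cst 1 x)%E.
  by rewrite integral_cst// mul1e.
rewrite ge0_integral_uniform01// (integral_itv01_cut _ v01 Bv)//.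
rewrite integral_cst//= mul1e lebesgue_measure_itv/= lte_fin sube0.
case/andP: v01 => + _.
by rewrite le_eqVlt => /predU1P[<-|->//]; rewrite ltxx.
Qed.

End uniform01.

(** * Integrating against a law given by a density *)

Section change_of_density.
Context d (T : measurableType d) (R : realType).
Variables (nu : {finite_measure set T -> \bar R})
  (mu : {sigma_finite_measure set T -> \bar R}) (f : T -> R).
Hypothesis mf : measurable_fun setT f.
Hypothesis nuE : forall A, measurable A ->
  (nu A = \int[mu]_(x in A) (f x)%:E)%E.

(** The Radon-Nikodym derivative of [nu] satisfies this identity, and it agrees
almost everywhere with [f] since both have the same integrals. *)
Lemma ge0_integral_density (E : set T) (h : T -> \bar R) : measurable E ->
    measurable_fun setT h -> (forall x, 0 <= h x)%E ->
  (\int[nu]_(x in E) h x = \int[mu]_(x in E) (h x * (f x)%:E))%E.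
Proof.
move=> mE mh h0.
have numu : nu `<< mu.
  apply/null_content_dominatesP => A mA muA0; rewrite nuE//.
  apply: null_set_integral => //.
  by apply/measurable_EFinP; exact: measurable_funTS.
have mEf : measurable_fun setT (EFin \o f) by exact/measurable_EFinP.
rewrite -(Radon_Nikodym_SigmaFinite.change_of_variables numu) //; last first.
  exact: measurable_funTS.
have mRN := measurable_int _ (Radon_Nikodym_SigmaFinite.f_integrable numu).
apply: ae_eq_integral => //.
- by apply: measurable_funTS; exact: emeasurable_funM.
- by apply: measurable_funTS; exact: emeasurable_funM.
- apply: ae_eqe_mul2l; apply: (@ae_eq_subset _ _ _ _ _ setT) => //.
  apply: integral_ae_eq => //.
  + exact: Radon_Nikodym_SigmaFinite.f_integrable.
  + by move=> A _ mA; rewrite -nuE// -Radon_Nikodym_SigmaFinite.f_integral.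
Qed.

End change_of_density.

(** * The quantile function of a law with a density *)

Section quantile.
Context (R : realType) (nu : probability (measurableTypeR R) R) (f : R -> R).
Hypothesis mf : measurable_fun setT f.
Hypothesis nuE : forall A, measurable A ->
  (nu A = \int[lebesgue_measure]_(x in A) (f x)%:E)%E.

Let idTR : measurableTypeR R -> R := idfun.

#[local] HB.instance Definition _ :=
  @isMeasurableFun.Build _ _ _ _ idTR (@measurable_id _ _ setT).

Local Notation G := (cdf (idTR : {RV nu >-> R})).
Local Notation F := (density_cdf f).
Local Notation Q := (quantile (density_cdf f)).
Local Notation U := (uniform_prob (@ltr01 R)).

Lemma density_cdfE x : (F x)%:E = G x.
Proof.
rewrite /density_cdf /Rintegral -nuE// fineK//.
exact: fin_num_measure.
Qed.

Lemma density_cdf_nd : nondecreasing_fun F.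
Proof. by move=> x y xy; rewrite -lee_fin !density_cdfE cdf_nondecreasing. Qed.

Lemma density_cdf_itv01 x : 0 <= F x <= 1.
Proof. by rewrite -!lee_fin density_cdfE cdf_ge0 cdf_le1. Qed.

Lemma density_cdf_fine : F = fine \o G.
Proof. by apply/funext => x /=; rewrite -density_cdfE. Qed.

Lemma density_cdf_cvgy : F x @[x --> +oo] --> (1:R).
Proof. by rewrite density_cdf_fine; exact/fine_cvg/cvg_cdfy1. Qed.

Lemma density_cdf_cvgNy : F x @[x --> -oo] --> (0:R).
Proof. by rewrite density_cdf_fine; exact/fine_cvg/cvg_cdfNy0. Qed.

Lemma density_cdf_right_continuous : right_continuous F.
Proof.
rewrite density_cdf_fine => a; apply: fine_cvg.
by rewrite fineK ?fin_num_measure//; exact: cdf_right_continuous.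
Qed.

Lemma quantile_has_inf (t : R) : 0 < t < 1 -> has_inf [set x | t <= F x].
Proof.
move=> /andP[t0 t1]; split.
  have [x tFx] := filter_ex (cvgr_gt _ density_cdf_cvgy _ t1).
  by exists x; exact: ltW.
have [x Fxt] := filter_ex (cvgr_lt _ density_cdf_cvgNy _ t0).
exists x => y /= tFy; rewrite leNgt; apply/negP => /ltW/density_cdf_nd.
by rewrite leNgt (lt_le_trans Fxt).
Qed.

(** The Galois connection between [Q] and [F]: right continuity of [F] makes the
infimum that defines [Q t] attained. *)
Lemma quantile_le (t x : R) : 0 < t < 1 -> (Q t <= x) = (t <= F x).
Proof.
move=> t01; have hi := quantile_has_inf t01; apply/idP/idP; last first.
  by move=> tFx; apply: ge_inf => //; exact: hi.2.
move=> Qx; apply: le_trans (density_cdf_nd Qx); rewrite leNgt; apply/negP => Ft.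
(* F stays below t a little to the right of Q t, where the set that defines
   Q t already has elements. *)
have [y [Fyt Qy]] : exists y, F y < t /\ Q t < y.
  apply: (@filter_ex _ (Q t)^'+); apply: filterI; last exact: nbhs_right_gt.
  exact: cvgr_lt (@density_cdf_right_continuous (Q t)) _ Ft.
have [z tFz zy] : exists2 z, t <= F z & z < Q t + (y - Q t).
  by apply: (inf_adherent _ hi); rewrite subr_gt0.
rewrite addrC subrK in zy.
move: (le_lt_trans tFz (le_lt_trans (density_cdf_nd (ltW zy)) Fyt)).
by rewrite ltxx.
Qed.

Lemma density_no_atom a : nu [set a] = 0%E.
Proof. by rewrite nuE// integral_set1. Qed.

(** [F (Q t) >= t] holds for every law; the converse is where a density matters.
Strictly to the left of [Q t] the function [F] is below [t], and the point [Q t]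
itself carries no mass. *)
Lemma density_cdf_quantile (t : R) : 0 < t < 1 -> F (Q t) = t.
Proof.
move=> t01; apply/eqP; rewrite eq_le -quantile_le// lexx andbT.
rewrite -lee_fin density_cdfE /cdf.
rewrite -(@setUitv1 _ _ -oo%O _ true)// measureU//; last first.
  apply/seteqP; split => // x/= []; rewrite in_itv/= => /[swap] ->.
  by rewrite ltxx.
rewrite [X in (_ + X <= _)%E]density_no_atom adde0.
pose I n : set (measurableTypeR R) := `]-oo, Q t - n.+1%:R^-1]%classic.
have -> : `]-oo, Q t[%classic = \bigcup_n I n.
  apply/seteqP; split => x /=; rewrite in_itv/=.
    move=> xQ; have /ltr_add_invr[n xn] := xQ.
    by exists n => //; rewrite /I/= in_itv/= lerBrDr ltW.
  move=> [n _]; rewrite /I/= in_itv/= => /le_lt_trans; apply.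
  by rewrite ltrBlDr ltrDl invr_gt0.
have mI n : measurable (I n) by exact: measurable_itv.
have cvgI : (nu \o I) n @[n --> \oo] --> nu (\bigcup_n I n).
  apply: nondecreasing_cvg_mu => //; first exact: bigcup_measurable.
  move=> m n mn; apply/subsetPset => x; rewrite /I/= !in_itv/= => /le_trans.
  apply.
  by rewrite lerD2l lerN2 lef_pV2 ?posrE// ler_nat.
apply: (cvge_to_le cvgI); near=> n.
rewrite [leLHS](_ : _ = (F (Q t - n.+1%:R^-1))%:E); last first.
  by rewrite density_cdfE.
by rewrite lee_fin ltW// ltNge -quantile_le// -ltNge ltrBlDr ltrDl invr_gt0.
Unshelve. all: by end_near. Qed.

(** Outside the open interval the quantile can be the conventional infimum of an
unbounded or empty set, which breaks monotonicity; cut off there, it is monotone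
on an interval and constant elsewhere, hence measurable. *)
Definition quantile01 : R -> R := Q \_ `]0, 1[.

Let measurable_quantile01 : measurable_fun [set: R] quantile01.
Proof.
apply/(measurable_restrictT _ _).1 => //.
apply: (measurability (@RGenOInfty.G R)) => [|/= _ [_] [r] -> <-].
  exact: RGenOInfty.measurableE.
apply: is_interval_measurable => s t/=.
rewrite !in_itv/= !andbT => -[s01 rs] [t01 rt] u /andP[su ut].
have u01 : 0 < u < 1.
  case/andP: s01 => s0 _; case/andP: t01 => _ t1.
  by rewrite (lt_le_trans s0)//= (le_lt_trans ut).
split=> //; rewrite in_itv/= andbT; move: rs.
by rewrite !ltNge !quantile_le// -!ltNge => /lt_le_trans; exact.
Qed.

HB.instance Definition _ := @isMeasurableFun.Build _ _ _ _
  (quantile01 : measurableTypeR R -> measurableTypeR R) measurable_quantile01.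

Lemma quantile01E t : 0 < t < 1 -> quantile01 t = Q t.
Proof. by move=> t01; rewrite /quantile01 patchE mem_set//= in_itv. Qed.

(** Inverse transform sampling: by [quantile_le] the two laws give the same mass
to every left half-line, hence to the rays that generate the Borel sets. *)
Lemma quantile01_distribution A : measurable A ->
  distribution U (quantile01 : {RV U >-> measurableTypeR R}) A = nu A.
Proof.
apply: (@measure_unique _ R (measurableTypeR R) (@RGenOInfty.G R)
  (fun n => `](-n%:R), +oo[%classic) _ _ _ _
  (distribution U (quantile01 : {RV U >-> measurableTypeR R})) nu).
- exact: RGenOInfty.measurableE.
- move=> _ _ [a ->] [b ->]; exists (Num.max a b).
  by apply/seteqP; split => x /=; rewrite !in_itv/= !andbT gt_max;
    [move=> [-> ->]|move=> /andP].
- by move=> n; exists (- n%:R).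
- rewrite -subTset => x _.
  exists (Num.truncn (- x)).+1 => //=.
  by rewrite in_itv/= andbT ltrNl truncnS_gt.
- move=> _ [a ->]; rewrite -setCitvl.
  transitivity (1 - distribution U
      (quantile01 : {RV U >-> measurableTypeR R}) `]-oo, a]%classic)%E.
    exact: probability_setC.
  transitivity (1 - nu `]-oo, a]%classic)%E; last first.
    by apply/esym; exact: probability_setC.
  congr (1 - _)%E; rewrite [RHS](_ : _ = (F a)%:E); last first.
    by rewrite density_cdfE.
  have mQ : measurable (quantile01 @^-1` `]-oo, a]).
    by rewrite -[X in measurable X]setTI; exact: measurable_quantile01.
  apply: uniform01_cut; [exact: mQ|exact: density_cdf_itv01|].
  by move=> t t01; rewrite /= in_itv/= quantile01E// quantile_le.
- by move=> k; rewrite -ge0_fin_numE// fin_num_measure.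
Qed.

(** The change of variables [x = Q t], for a region given by [A] on one side and
by [t <= v] on the other; taking [A] arbitrary covers both the half-lines and
the sublevel sets of the distribution function. *)
Lemma ge0_integral_quantile (A : set R) (v : R) (h : R -> \bar R) :
    measurable A -> measurable_fun setT h -> (forall x, 0 <= h x)%E ->
    0 <= v <= 1 -> (forall t, 0 < t < 1 -> A (Q t) <-> t <= v) ->
  (\int[lebesgue_measure]_(t in `[0%R, v]) h (Q t) =
   \int[lebesgue_measure]_(x in A) (h x * (f x)%:E))%E.
Proof.
move=> mA mh h0 v01 Av.
transitivity (\int[nu]_(x in A) h x)%E; last first.
  exact: ge0_integral_density.
rewrite -(eq_measure_integral _ (fun B mB _ => quantile01_distribution mB)).
rewrite ge0_integral_pushforward//; last exact: measurable_funTS.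
have mhQ : measurable_fun setT (h \o quantile01) by exact: measurableT_comp.
have mQA : measurable (quantile01 @^-1` A).
  by rewrite -[X in measurable X]setTI; exact: measurable_quantile01.
rewrite ge0_integral_uniform01 => [|//|//|x]; last exact: h0.
rewrite (@integral_itv01_cut _ _ v); last first.
- by move=> t t01; rewrite /= quantile01E//; exact: Av.
- by [].
- exact: measurable_funTS.
have Q01 t : t \in `]0, v[%classic -> quantile01 t = Q t.
  rewrite inE/= in_itv/= => /andP[t0 tv]; apply: quantile01E.
  by case/andP: v01 => _ v1; rewrite t0 (lt_le_trans tv).
rewrite !(integral_itv_bndoo true false).
- by apply: eq_integral => t tv; rewrite /= Q01.
- exact: measurable_funTS.
- apply: (@eq_measurable_fun _ _ _ _ _ (h \o quantile01)).
    by move=> t tv; rewrite /= Q01.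
  exact: measurable_funTS.
Qed.

Lemma measurable_density_cdf : measurable_fun setT F.
Proof. by apply: nondecreasing_measurable => //; exact: density_cdf_nd. Qed.

(** The probability integral transform: [nu] is the uniform law carried by [Q],
and [F] undoes [Q]. *)
Lemma law_density_cdf (A : set R) : measurable A -> nu (F @^-1` A) = U A.
Proof.
move=> mA; have mFA : measurable (F @^-1` A).
  by rewrite -[X in measurable X]setTI; exact: measurable_density_cdf.
rewrite -quantile01_distribution//.
have mQFA : measurable (quantile01 @^-1` (F @^-1` A)).
  by rewrite -[X in measurable X]setTI; exact: measurable_quantile01.
transitivity (\int[U]_(x in quantile01 @^-1` (F @^-1` A)) cst 1 x)%E.
  by rewrite integral_cst// mul1e.
rewrite ge0_integral_uniform01//.
transitivity (\int[U]_(x in A) cst 1 x)%E; last by rewrite integral_cst// mul1e.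
rewrite [RHS]ge0_integral_uniform01//; congr integral.
apply/seteqP; split=> t /= [t01]; rewrite /= in_itv/= in t01 *.
  by rewrite quantile01E// density_cdf_quantile.
by rewrite quantile01E// density_cdf_quantile.
Qed.

End quantile.

(** * Boundary values of a copula *)

Section copula.
Context (R : realType).
Local Notation U := (uniform_prob (@ltr01 R)).
Implicit Types C : R -> R -> R.

Lemma uniform01_itvNyc (u : R) : 0 <= u <= 1 -> U `]-oo, u] = u%:E.
Proof. by move=> u01; apply: uniform01_cut => // t _; rewrite /= in_itv. Qed.

Lemma uniform01_itv1y : U `]1, +oo[ = 0%E.
Proof.
rewrite -setCitvl; transitivity (1 - U `]-oo, 1%R]%classic)%E.
  exact: probability_setC.
by rewrite uniform01_itvNyc ?ler01 ?lexx// subee.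
Qed.

(** A strip of uniform mass zero has measure zero for the joint law, so cutting
at [0] leaves nothing and cutting at [1] removes nothing. *)
Lemma copula_margins C : is_copula C -> forall u, 0 <= u <= 1 ->
  [/\ C 0 u = 0, C u 0 = 0, C 1 u = u & C u 1 = u].
Proof.
move=> [m [m1 m2 mC]] u u01.
have le00 : 0 <= (0 : R) <= 1 by rewrite lexx ler01.
have le11 : 0 <= (1 : R) <= 1 by rewrite lexx ler01.
have U0 : U `]-oo, 0] = 0%E by rewrite uniform01_itvNyc.
have nullL (A B : set R) : measurable A -> measurable B -> U A = 0%E ->
    m (A `*` B) = 0%E.
  move=> mA mB A0; apply/eqP; rewrite -measure_le0 -[leRHS]A0 -m1//.
  by rewrite le_measure ?inE//; [exact: measurableX..|move=> x []].
have nullR (A B : set R) : measurable A -> measurable B -> U B = 0%E ->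
    m (A `*` B) = 0%E.
  move=> mA mB B0; apply/eqP; rewrite -measure_le0 -[leRHS]B0 -m2//.
  by rewrite le_measure ?inE//; [exact: measurableX..|move=> x []].
have lr1 (x : R) : `]-oo, 1]%classic x \/ `]1, +oo[%classic x.
  by rewrite /= !in_itv/= andbT; case: (leP x 1) => _; [left|right].
have dis1 (x : R) : `]-oo, 1]%classic x -> ~ `]1, +oo[%classic x.
  by rewrite /= !in_itv/= andbT leNgt => /negP.
split; apply/EFin_inj; rewrite -mC//.
- exact: nullL.
- exact: nullR.
- rewrite -(uniform01_itvNyc u01) -m2//.
  rewrite (_ : setT `*` `]-oo, u] =
      `]-oo, 1] `*` `]-oo, u] `|` `]1, +oo[ `*` `]-oo, u]).
    rewrite measureU; [|exact: measurableX..|].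
      rewrite [X in (_ + X)%E]nullL ?adde0//; exact: uniform01_itv1y.
    by apply/seteqP; split => // -[x y] /= [[/dis1 + _] [+ _]].
  apply/seteqP; split => [[x y] [_ yu]|[x y] [[]|[]]//].
  by case: (lr1 x) => ?; [left|right].
- rewrite -(uniform01_itvNyc u01) -m1//.
  rewrite (_ : `]-oo, u] `*` setT =
      `]-oo, u] `*` `]-oo, 1] `|` `]-oo, u] `*` `]1, +oo[).
    rewrite measureU; [|exact: measurableX..|].
      rewrite [X in (_ + X)%E]nullR ?adde0//; exact: uniform01_itv1y.
    by apply/seteqP; split => // -[x y] /= [[_ /dis1 +] [_ +]].
  apply/seteqP; split => [[x y] [xu _]|[x y] [[]|[]]//].
  by case: (lr1 y) => ?; [left|right].
Qed.

End copula.

(** * Reversible kernels that either move with a density or stay *)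

Section reversible_kernel.
Context (R : realType) (f : R -> R) (k : R -> R -> R).
Local Notation mu := (@lebesgue_measure R).
Hypotheses (mf : measurable_fun setT f) (f_ge0 : forall x, 0 <= f x).
Hypothesis mk : measurable_fun setT (fun p : R * R => k p.1 p.2).
Hypothesis k_ge0 : forall x y, 0 <= k x y.
Hypothesis k_le1 : forall x, (\int[mu]_y (k x y)%:E <= 1)%E.

Definition move_mass (x : R) (B : set R) : \bar R :=
  (\int[mu]_(y in B) (k x y)%:E)%E.
Definition stay_mass (x : R) : \bar R := (1 - move_mass x setT)%E.

Lemma measurable_density_section x : measurable_fun setT (k x).
Proof.
change (measurable_fun setT ((fun p : R * R => k p.1 p.2) \o pair x)).
by apply: measurableT_comp => //; exact: measurable_pair1.
Qed.

Lemma move_mass_ge0 x B : (0 <= move_mass x B)%E.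
Proof. by apply: integral_ge0 => y _; rewrite lee_fin. Qed.

Lemma move_mass_le1 x B : measurable B -> (move_mass x B <= 1)%E.
Proof.
move=> mB; apply: le_trans (k_le1 x); apply: ge0_subset_integral => //.
- by apply/measurable_EFinP; exact: measurable_density_section.
- by move=> y _; rewrite lee_fin.
Qed.

Lemma move_mass_fin_num x B : measurable B -> move_mass x B \is a fin_num.
Proof.
move=> mB; rewrite ge0_fin_numE ?move_mass_ge0//.
by rewrite (le_lt_trans (move_mass_le1 x mB))// ltry.
Qed.

Lemma stay_mass_ge0 x : (0 <= stay_mass x)%E.
Proof. by rewrite /stay_mass sube_ge0 ?move_mass_le1// move_mass_fin_num. Qed.

(** The integrand of the double integrals below, in the form that Tonelli's
theorem takes: the factor [\1_B] turns an integral over [B] into one over the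
line, and the weight [g] is [1] or the density. *)
Lemma measurable_kernel_slice (g : R -> R) (B : set R) : measurable B ->
    measurable_fun setT g ->
  measurable_fun setT (fun p : measurableTypeR R * measurableTypeR R =>
    (g p.1 * (k p.1 p.2 * \1_B p.2))%:E).
Proof.
move=> mB mg; apply/measurable_EFinP; apply: measurable_funM.
  exact: measurableT_comp.
apply: measurable_funM; first exact: mk.
by apply: (measurableT_comp (measurable_indic mB)).
Qed.

Lemma move_massE x B : move_mass x B = (\int[mu]_y (k x y * \1_B y)%:E)%E.
Proof.
rewrite /move_mass integral_mkcond; apply: eq_integral => y _.
by rewrite patchE indicE; case: ifPn; rewrite ?mulr1 ?mulr0.
Qed.

Lemma measurable_move_mass B : measurable B ->
  measurable_fun setT (move_mass ^~ B).
Proof.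
move=> mB; rewrite (_ : move_mass ^~ B = fubini_F mu
    (fun p => (cst 1 p.1 * (k p.1 p.2 * \1_B p.2))%:E)); last first.
  apply/funext => x; rewrite move_massE.
  by apply: eq_integral => y _; rewrite mul1r.
apply: measurable_fun_fubini_tonelli_F.
  exact: measurable_kernel_slice.
by move=> p; rewrite lee_fin mul1r mulr_ge0.
Qed.

Lemma measurable_stay_mass : measurable_fun setT stay_mass.
Proof. by apply: emeasurable_funB => //; exact: measurable_move_mass. Qed.

Section joint_law.
Variable nu : probability (measurableTypeR R) R.
Hypothesis nuE : forall A : set R, measurable A ->
  (nu A = \int[mu]_(x in A) (f x)%:E)%E.

Let density := @ge0_integral_density _ (measurableTypeR R) R nu mu f mf nuE.

Lemma integral_move_stay (A B : set R) : measurable A -> measurable B ->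
  (\int[nu]_(x in A) (move_mass x B + stay_mass x * \d_x B) =
   \int[mu]_(x in A) (move_mass x B * (f x)%:E) +
   \int[mu]_(x in A `&` B) (stay_mass x * (f x)%:E))%E.
Proof.
move=> mA mB.
have mM := measurable_move_mass mB.
rewrite ge0_integralD//; last 4 first.
- by move=> x _; exact: move_mass_ge0.
- exact: measurable_funTS.
- by move=> x _; rewrite mule_ge0// stay_mass_ge0.
- apply: measurable_funTS; apply: emeasurable_funM.
    exact: measurable_stay_mass.
  exact/measurable_EFinP/measurable_indic.
congr (_ + _)%E.
  by apply: density => // x; exact: move_mass_ge0.
transitivity (\int[nu]_(x in A `&` B) stay_mass x)%E.
  rewrite integral_mkcondr; apply: eq_integral => x _.
  by rewrite patchE diracE; case: ifPn; rewrite ?mule1 ?mule0.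
apply: density; first exact: measurableI.
  exact: measurable_stay_mass.
by move=> x; exact: stay_mass_ge0.
Qed.

(** Real-valued iterated integrals collapse to [0] when an extended-real one is
infinite; this bound by the total mass of [nu] rules that out. *)
Lemma integral_mass_fin_num (A : set R) (h : R -> \bar R) : measurable A ->
    measurable_fun setT h -> (forall x, 0 <= h x <= 1)%E ->
  (\int[mu]_(x in A) (h x * (f x)%:E))%E \is a fin_num.
Proof.
move=> mA mh h01; have h0 x : (0 <= h x)%E by case/andP: (h01 x).
rewrite -density// ge0_fin_numE ?integral_ge0//.
apply: (@le_lt_trans _ _ (\int[nu]_(x in A) cst 1 x)%E); last first.
  by rewrite integral_cst// mul1e ltey_eq fin_num_measure.
apply: ge0_le_integral => //; first exact: measurable_funTS.
by move=> x _; case/andP: (h01 x).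
Qed.

Lemma stay_mass_le1 x : (stay_mass x <= 1)%E.
Proof.
by rewrite /stay_mass leeBlDr ?move_mass_fin_num// leeDl// move_mass_ge0.
Qed.

Hypothesis k_rev : forall x y, f x * k x y = f y * k y x.

(** Detailed balance under Tonelli's theorem: the mass that moves into [B]
equals the mass that moves out of [B], moves within [B] counting on both sides. *)
Lemma integral_move_rev (B : set R) : measurable B ->
  (\int[mu]_x (move_mass x B * (f x)%:E) =
   \int[mu]_(x in B) (move_mass x setT * (f x)%:E))%E.
Proof.
move=> mB.
transitivity (\int[mu]_x \int[mu]_y (f x * (k x y * \1_B y))%:E)%E.
  apply: eq_integral => x _; rewrite move_massE muleC -ge0_integralZl_EFin//.
  - by move=> y _; rewrite lee_fin mulr_ge0.
  - apply/measurable_EFinP; apply: measurable_funM => //.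
    exact: measurable_density_section.
rewrite (@fubini_tonelli _ _ (measurableTypeR R) (measurableTypeR R) R mu mu
  (fun p => (f p.1 * (k p.1 p.2 * \1_B p.2))%:E)); last 2 first.
- exact: measurable_kernel_slice.
- by move=> p; rewrite lee_fin !mulr_ge0.
rewrite [RHS]integral_mkcond; apply: eq_integral => y _.
rewrite patchE -[X in if X then _ else _]/(y \in B).
transitivity (\int[mu]_x ((f y * \1_B y)%:E * (k y x)%:E))%E.
  by apply: eq_integral => x _; rewrite -EFinM mulrA k_rev mulrAC.
rewrite ge0_integralZl_EFin//; last 3 first.
- by move=> x _; rewrite lee_fin.
- by apply/measurable_EFinP; exact: measurable_density_section.
- by rewrite mulr_ge0.
by rewrite indicE; case: ifPn => _; rewrite ?mulr1 ?mulr0 ?mul0e // muleC.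
Qed.

(** Stationarity: the mass entering [B] equals the mass leaving [B], which
together with the mass staying in [B] is all of [nu B]. *)
Lemma integral_move_stay_law (B : set R) : measurable B ->
  (\int[nu]_x (move_mass x B + stay_mass x * \d_x B) = nu B)%E.
Proof.
move=> mB; rewrite integral_move_stay// integral_move_rev// setTI.
have mf' : measurable_fun setT (fun x => (f x)%:E) by exact/measurable_EFinP.
rewrite -ge0_integralD//; last 4 first.
- by move=> x _; rewrite mule_ge0 ?move_mass_ge0 ?lee_fin.
- apply: measurable_funTS; apply: emeasurable_funM => //.
  exact: measurable_move_mass.
- by move=> x _; rewrite mule_ge0 ?stay_mass_ge0 ?lee_fin.
- apply: measurable_funTS; apply: emeasurable_funM => //.
  exact: measurable_stay_mass.
rewrite nuE//; apply: eq_integral => x _.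
rewrite -muleDl ?fin_num_adde_defr ?move_mass_fin_num//.
by rewrite /stay_mass addeC subeK ?mul1e// move_mass_fin_num.
Qed.

Local Notation Q := (quantile (density_cdf f)).
Hypothesis k_out : forall x y, f y = 0 -> k x y = 0.

Let quantile_cov := ge0_integral_quantile mf nuE.

(** The quotient by [f] cancels the density that the change of variables brings
in; where [f] vanishes, so does [k]. *)
Lemma move_mass_quantile x (B : set R) (v : R) : measurable B ->
    0 <= v <= 1 -> (forall t, 0 < t < 1 -> B (Q t) <-> t <= v) ->
  (\int[mu]_(z in `[0%R, v]) (k x (Q z) / f (Q z))%R%:E)%E = move_mass x B.
Proof.
move=> mB v01 Bv.
rewrite (quantile_cov (h := fun y => (k x y / f y)%:E) mB _ _ v01 Bv).
- apply: eq_integral => y _; rewrite -EFinM; have [fy0|fy0] := eqVneq (f y) 0.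
    by rewrite k_out// fy0 mulr0.
  by rewrite divfK.
- apply/measurable_EFinP; apply: measurable_fun_div => //.
  exact: measurable_density_section.
- by move=> y; rewrite lee_fin divr_ge0.
Qed.

(** The inner integral of the copula formula, for a general kernel density. *)
Let inner (v t : R) : R := \int[mu]_(z in `[0, v]) (k (Q t) (Q z) / f (Q z)).

Lemma Rintegral_move_quantile (A B : set R) (u v : R) :
    measurable A -> measurable B -> 0 <= u <= 1 -> 0 <= v <= 1 ->
    (forall t, 0 < t < 1 -> A (Q t) <-> t <= u) ->
    (forall t, 0 < t < 1 -> B (Q t) <-> t <= v) ->
  ((\int[mu]_(t in `[0, u]) inner v t)%:E =
   \int[mu]_(x in A) (move_mass x B * (f x)%:E))%E.
Proof.
move=> mA mB u01 v01 Au Bv; rewrite /Rintegral.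
rewrite (eq_integral (fun t : measurableTypeR R => move_mass (Q t) B));
    last first.
  move=> t _; rewrite /inner /Rintegral (move_mass_quantile _ mB v01 Bv).
  rewrite fineK//.
  exact: move_mass_fin_num.
rewrite (quantile_cov (h := move_mass ^~ B) mA _ _ u01 Au).
- rewrite fineK//; apply: integral_mass_fin_num => //.
    exact: measurable_move_mass.
  by move=> x; rewrite move_mass_ge0 move_mass_le1.
- exact: measurable_move_mass.
- by move=> x; exact: move_mass_ge0.
Qed.

Lemma Rintegral_stay_quantile (A : set R) (u : R) :
    measurable A -> 0 <= u <= 1 ->
    (forall t, 0 < t < 1 -> A (Q t) <-> t <= u) ->
  ((\int[mu]_(t in `[0, u]) (1 - inner 1 t))%:E =
   \int[mu]_(x in A) (stay_mass x * (f x)%:E))%E.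
Proof.
move=> mA u01 Au; rewrite /Rintegral.
rewrite (eq_integral (fun t : measurableTypeR R => stay_mass (Q t)));
    last first.
  move=> t _; rewrite /inner /Rintegral (move_mass_quantile _ measurableT).
  - by rewrite EFinB fineK// move_mass_fin_num.
  - by rewrite ler01 lexx.
  - by move=> s /andP[_ /ltW].
rewrite (quantile_cov (h := stay_mass) mA _ _ u01 Au).
- rewrite fineK//; apply: integral_mass_fin_num => //.
    exact: measurable_stay_mass.
  by move=> x; rewrite stay_mass_ge0 stay_mass_le1.
- exact: measurable_stay_mass.
- exact: stay_mass_ge0.
Qed.

End joint_law.

End reversible_kernel.

(** * The Metropolis-Hastings kernel *)

Section mh_density.
Context (R : realType) (D : set R) (f : R -> R) (q : R -> R -> R).
Local Notation mu := (@lebesgue_measure R).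

(** The move density is extended by zero, since off [D] the proposal is
arbitrary and need not be measurable. *)
Definition mh_density (x y : R) : R :=
  ((fun p : R * R => q p.1 p.2 * mh_accept f q p.1 p.2) \_ (D `*` D)) (x, y).

Hypotheses (mD : measurable D) (mf : measurable_fun setT f).
Hypothesis f_gt0 : forall x, D x -> 0 < f x.
Hypothesis f_out : forall x, ~ D x -> f x = 0.
Hypothesis mq : measurable_fun (D `*` D) (fun p : R * R => q p.1 p.2).
Hypothesis q_gt0 : forall x y, D x -> D y -> 0 < q x y.
Hypothesis q_int1 : forall x, D x -> (\int[mu]_(y in D) (q x y)%:E = 1)%E.

Lemma mh_densityE x y : D x -> D y ->
  mh_density x y = q x y * mh_accept f q x y.
Proof. by move=> Dx Dy; rewrite /mh_density patchE mem_set. Qed.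

Lemma mh_density_out x y : ~ (D x /\ D y) -> mh_density x y = 0.
Proof. by move=> Dxy; rewrite /mh_density patchE memNset. Qed.

Lemma mh_accept_ge0 x y : D x -> D y -> 0 <= mh_accept f q x y.
Proof.
move=> Dx Dy; rewrite /mh_accept le_min ler01 andbT.
by rewrite divr_ge0// mulr_ge0// ltW// ?f_gt0 ?q_gt0.
Qed.

(** Here the division by [f x * q x y = 0] gives [0] by convention. *)
Lemma mh_accept_out x y : ~ D x -> mh_accept f q x y = 0.
Proof.
move=> Dx; rewrite /mh_accept (f_out Dx) mul0r invr0 mulr0.
by rewrite (elimT min_idPl) ?ler01.
Qed.

Lemma mh_density_ge0 x y : 0 <= mh_density x y.
Proof.
have [[Dx Dy]|Dxy] := pselect (D x /\ D y); last by rewrite mh_density_out.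
by rewrite mh_densityE// mulr_ge0 ?mh_accept_ge0// ltW// q_gt0.
Qed.

(** On [D] both sides are the minimum of [f x * q x y] and [f y * q y x]; elsewhere
both vanish. *)
Lemma mh_density_rev x y : f x * mh_density x y = f y * mh_density y x.
Proof.
have [[Dx Dy]|Dxy] := pselect (D x /\ D y); last first.
  by rewrite !mh_density_out ?mulr0// => -[Dy Dx]; apply: Dxy.
rewrite !mh_densityE// !mulrA /mh_accept !minr_pMr ?mulr_ge0//; last 4 first.
- exact/ltW/f_gt0.
- exact/ltW/q_gt0.
- exact/ltW/f_gt0.
- exact/ltW/q_gt0.
have fq x' y' : D x' -> D y' -> f x' * q x' y' != 0.
  by move=> Dx' Dy'; rewrite mulf_neq0 ?gt_eqF ?f_gt0 ?q_gt0.
by rewrite !mulr1 ![_ * q _ _ * (_ / _)]mulrC !divfK ?fq// minC.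
Qed.

Lemma mh_density_out_r x y : f y = 0 -> mh_density x y = 0.
Proof.
move=> fy0; apply: mh_density_out => -[_ /f_gt0].
by rewrite fy0 ltxx.
Qed.

Lemma measurable_mh_density :
  measurable_fun setT (fun p : R * R => mh_density p.1 p.2).
Proof.
have mDD : measurable (D `*` D) by exact: measurableX.
rewrite (_ : (fun p => _) =
    (fun p : R * R => q p.1 p.2 * mh_accept f q p.1 p.2) \_ (D `*` D));
    last first.
  by apply/funext => -[].
apply/(measurable_restrictT _ _).1 => //; apply: measurable_funM => //.
have mq' : measurable_fun (D `*` D) (fun p : R * R => q p.2 p.1).
  rewrite (_ : (fun p => _) =
    (fun p : R * R => q p.1 p.2) \o (fun p => (p.2, p.1)))//.
  apply: (measurable_comp mDD) => //; first by move=> _ [[x y] [Dx Dy] <-].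
  by apply: measurable_funTS; exact: measurable_fun_pair.
apply: measurable_minr => //.
apply: measurable_fun_div; apply: measurable_funM => //.
- by apply: measurable_funTS; exact: (measurableT_comp mf).
- by apply: measurable_funTS; exact: (measurableT_comp mf).
Qed.

Lemma mh_density_le1 x : (\int[mu]_y (mh_density x y)%:E <= 1)%E.
Proof.
have [Dx|Dx] := pselect (D x); last first.
  rewrite integral0_eq ?lee01// => y _.
  by rewrite mh_density_out// => -[].
rewrite -(q_int1 Dx) [leRHS]integral_mkcond.
have mqx : measurable_fun D (q x).
  rewrite (_ : q x = (fun p : R * R => q p.1 p.2) \o pair x)//.
  apply: (@measurable_comp _ _ _ _ _ _ (D `*` D)) => //.
  - exact: measurableX.
  - by move=> _ [y Dy <-].
  - by apply: measurable_funTS; exact: measurable_pair1.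
apply: ge0_le_integral => //.
- by move=> y _; rewrite lee_fin mh_density_ge0.
- apply/measurable_EFinP.
  exact: (measurable_density_section measurable_mh_density).
- apply/(measurable_restrictT _ _).1 => //; exact/measurable_EFinP.
- move=> y _; rewrite patchE; case: ifPn => [/set_mem Dy|/negP Dy].
    rewrite lee_fin mh_densityE// -[leRHS]mulr1 ler_wpM2l//.
      by rewrite ltW// q_gt0.
    by rewrite /mh_accept ge_min lexx orbT.
  by rewrite mh_density_out// => -[_ Dy']; apply: Dy; rewrite inE.
Qed.

(** Off [D] the acceptance ratio vanishes, so both sides are the point mass at
[x]. *)
Lemma mh_kernelE x B :
  mh_kernel D f q x B =
  (move_mass mh_density x B + stay_mass mh_density x * \d_x B)%E.
Proof.
have moveE C : (\int[mu]_(y in C `&` D) (q x y * mh_accept f q x y)%:E)%E =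
    move_mass mh_density x C.
  rewrite integral_mkcondr; apply: eq_integral => y _; rewrite patchE.
  have [Dx|Dx] := pselect (D x); last first.
    rewrite mh_density_out => [|[]//].
    by rewrite mh_accept_out// mulr0; case: ifP.
  case: ifPn => [/set_mem Dy|/negP Dy]; first by rewrite mh_densityE.
  by rewrite mh_density_out// => -[_ Dy']; apply: Dy; rewrite inE.
by rewrite /mh_kernel moveE -[D in X in (1 - X)%E]setTI moveE.
Qed.

Lemma mh_copula_integrandE t z :
  mh_copula_integrand f q t z =
  let Finv := quantile (density_cdf f) in
  mh_density (Finv t) (Finv z) / f (Finv z).
Proof.
rewrite /mh_copula_integrand /=; set x := quantile _ t; set y := quantile _ z.
have [Dy|Dy] := pselect (D y); last by rewrite (f_out Dy) invr0 !mulr0 mul0r.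
have [Dx|Dx] := pselect (D x); last first.
  by rewrite mh_accept_out// mulr0 mh_density_out ?mul0r// => -[].
by rewrite mh_densityE// mulrAC.
Qed.

End mh_density.

(** * The copula of the stationary chain *)

Section stationary_chain.
Context (R : realType) (D : set R) (f : R -> R) (q : R -> R -> R).
Local Notation mu := (@lebesgue_measure R).
Hypotheses (mD : measurable D) (mf : measurable_fun setT f).
Hypothesis f_gt0 : forall x, D x -> 0 < f x.
Hypothesis f_out : forall x, ~ D x -> f x = 0.
Hypothesis mq : measurable_fun (D `*` D) (fun p : R * R => q p.1 p.2).
Hypothesis q_gt0 : forall x y, D x -> D y -> 0 < q x y.
Hypothesis q_int1 : forall x, D x -> (\int[mu]_(y in D) (q x y)%:E = 1)%E.
Context d (T : measurableType d) (P : probability T R).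
Variable X : nat -> {RV P >-> R}.
Hypothesis hX : stationary_mh_chain D f q X.

Local Notation k := (mh_density D f q).
Local Notation F := (density_cdf f).
Local Notation Q := (quantile (density_cdf f)).
Let f_ge0 x : 0 <= f x.
Proof. by have [/f_gt0/ltW|/f_out->] := pselect (D x). Qed.

(** Lebesgue measure lives on [measurableTypeR R], whose display differs from
that of [R]; [X0] has the law of [X 0] on that copy of the line. *)
Let X0 : T -> measurableTypeR R := X 0%N.

#[local] HB.instance Definition _ :=
  @isMeasurableFun.Build _ _ T (measurableTypeR R) X0
    (@measurable_funPT _ _ _ _ (X 0%N)).

Let nu : probability (measurableTypeR R) R := distribution P X0.

Let nuE (A : set R) : measurable A -> (nu A = \int[mu]_(x in A) (f x)%:E)%E.
Proof. exact: hX.1. Qed.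

Let mk := measurable_mh_density mD mf mq.
Let k_ge0 := mh_density_ge0 f_gt0 q_gt0.
Let k_le1 := mh_density_le1 mD mf f_gt0 mq q_gt0 q_int1.
Let k_rev := mh_density_rev f_gt0 q_gt0.
Let k_out := fun x y => @mh_density_out_r R D f q f_gt0 x y.

Lemma chain_joint_law (A B : set R) : measurable A -> measurable B ->
  P (X 0%N @^-1` A `&` X 1%N @^-1` B) =
  (\int[nu]_(x in A) (move_mass k x B + stay_mass k x * \d_x B))%E.
Proof.
move=> mA mB.
have E : \bigcap_(i in `I_1) (X i @^-1` A) = X 0%N @^-1` A.
  apply/seteqP; split=> w; first by apply.
  by move=> Aw [|i]//= _.
have := hX.2 0%N (fun=> A) B (fun=> mA) mB; rewrite E => ->.
have mK : measurable_fun setT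
    (fun x => move_mass k x B + stay_mass k x * \d_x B)%E.
  apply: emeasurable_funD; first exact: measurable_move_mass.
  apply: emeasurable_funM; first exact: measurable_stay_mass.
  exact/measurable_EFinP/measurable_indic.
have K0 x : (0 <= move_mass k x B + stay_mass k x * \d_x B)%E.
  by rewrite adde_ge0 ?move_mass_ge0// mule_ge0 ?stay_mass_ge0.
transitivity (\int[P]_(w in X0 @^-1` A)
    (move_mass k (X0 w) B + stay_mass k (X0 w) * \d_(X0 w) B))%E.
  by apply: eq_integral => w _; rewrite mh_kernelE.
rewrite -(@ge0_integral_pushforward _ _ _ (measurableTypeR R) R X0 _ P A
  (fun x => (move_mass k x B + stay_mass k x * \d_x B)%E)) //.
exact: measurable_funTS.
Qed.

Lemma chain_law1 (B : set R) : measurable B -> P (X 1%N @^-1` B) = nu B.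
Proof.
move=> mB; rewrite -[X in P X]setTI -(preimage_setT (X 0%N)) chain_joint_law//.
exact: (integral_move_stay_law mf f_ge0 mk k_ge0 k_le1 nuE k_rev mB).
Qed.

(** The sets [A] and [B] enter only through the levels [u] and [v] at which the
quantile function crosses them; the mass that stays lies in both, hence the
minimum of the two levels. *)
Lemma chain_joint_copula (A B : set R) (u v : R) :
    measurable A -> measurable B -> 0 <= u <= 1 -> 0 <= v <= 1 ->
    (forall t, 0 < t < 1 -> A (Q t) <-> t <= u) ->
    (forall t, 0 < t < 1 -> B (Q t) <-> t <= v) ->
  P (X 0%N @^-1` A `&` X 1%N @^-1` B) = (mh_AC f q u v + mh_SC f q u v)%:E.
Proof.
move=> mA mB u01 v01 Au Bv.
have gE : mh_copula_integrand f q = fun t z => k (Q t) (Q z) / f (Q z).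
  apply/funext => t; apply/funext => z.
  by rewrite (mh_copula_integrandE _ f_out).
rewrite chain_joint_law// (integral_move_stay mf mk k_ge0 k_le1 nuE mA mB).
rewrite EFinD; congr (_ + _)%E.
  rewrite -(Rintegral_move_quantile mf f_ge0 mk k_ge0 k_le1 nuE k_out mA mB
    u01 v01 Au Bv).
  by rewrite /mh_AC gE.
have w01 : 0 <= Num.min u v <= 1.
  case/andP: u01 => u0 u1; case/andP: v01 => v0 _.
  by rewrite le_min u0 v0 ge_min u1.
have ABw t : 0 < t < 1 -> (A `&` B) (Q t) <-> t <= Num.min u v.
  move=> t01; rewrite le_min; split.
    by move=> [/(Au _ t01) -> /(Bv _ t01) ->].
  by move=> /andP[tu tv]; split; [apply/(Au _ t01)|apply/(Bv _ t01)].
rewrite -(Rintegral_stay_quantile mf f_ge0 mk k_ge0 k_le1 nuE k_out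
  (measurableI _ _ mA mB) w01 ABw).
by rewrite /mh_SC gE.
Qed.

Let FX (w : T) : R * R := (F (X 0%N w), F (X 1%N w)).

Let measurable_FX : measurable_fun setT FX.
Proof.
have mFX i : measurable_fun setT (F \o X i).
  by apply: measurableT_comp => //; exact: (measurable_density_cdf nuE).
exact: (measurable_fun_pair (mFX 0%N) (mFX 1%N)).
Qed.

#[local] HB.instance Definition _ :=
  @isMeasurableFun.Build _ _ T (R * R)%type FX measurable_FX.

Lemma chain_cdf_quantile t : 0 < t < 1 -> F (Q t) = t.
Proof. exact: density_cdf_quantile nuE _. Qed.

(** The witness is the law of [(F X_0, F X_1)].  Sublevel sets of [F] reach the
levels [0] and [1], which [F] itself need not attain. *)
Lemma mh_is_copula : is_copula (fun u v => mh_AC f q u v + mh_SC f q u v).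
Proof.
have mF (A : set R) : measurable A -> measurable (F @^-1` A).
  move=> mA; rewrite -[X in measurable X]setTI.
  exact: (measurable_density_cdf nuE).
exists (distribution P (FX : {RV P >-> (R * R)%type})); split.
- move=> A mA; rewrite -(law_density_cdf nuE mA).
  rewrite /distribution /pushforward; congr (P _).
  by apply/seteqP; split => [w [] //|w].
- move=> A mA; rewrite -(law_density_cdf nuE mA) -chain_law1; last exact: mF.
  rewrite /distribution /pushforward; congr (P _).
  by apply/seteqP; split => [w [] //|w].
- move=> u v u01 v01.
  have Fcut w t : 0 < t < 1 -> (F @^-1` `]-oo, w]) (Q t) <-> t <= w.
    by move=> t01; rewrite /= in_itv/= (density_cdf_quantile nuE).
  rewrite -(chain_joint_copula _ _ u01 v01 (Fcut u) (Fcut v)); [|exact: mF..].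
  rewrite /distribution /pushforward; congr (P _).
Qed.

Lemma mh_copula_joint x y :
  P (X 0%N @^-1` `]-oo, x] `&` X 1%N @^-1` `]-oo, y]) =
  (mh_AC f q (F x) (F y) + mh_SC f q (F x) (F y))%:E.
Proof.
apply: chain_joint_copula => //; try exact: (density_cdf_itv01 nuE).
- by move=> t t01; rewrite /= in_itv/= (quantile_le nuE).
- by move=> t t01; rewrite /= in_itv/= (quantile_le nuE).
Qed.

End stationary_chain.

Theorem proposition4 (R : realType) (D : set R) (f : R -> R) (q : R -> R -> R)
    (mD : measurable D)
    (mf : measurable_fun setT f)
    (f_gt0 : forall x, D x -> 0 < f x)
    (f_out : forall x, ~ D x -> f x = 0)
    (f_int1 : (\int[lebesgue_measure]_x (f x)%:E = 1)%E)
    (mq : measurable_fun (D `*` D) (fun p : R * R => q p.1 p.2))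
    (q_gt0 : forall x y, D x -> D y -> 0 < q x y)
    (q_int1 : forall x, D x ->
       (\int[lebesgue_measure]_(y in D) (q x y)%:E = 1)%E)
    (d : measure_display) (T : measurableType d) (P : probability T R)
    (X : nat -> {RV P >-> R})
    (hX : stationary_mh_chain D f q X) :
  copula_of (X 0%N) (X 1%N) (density_cdf f) (density_cdf f)
    (fun u v => mh_AC f q u v + mh_SC f q u v) /\
  (forall C : R -> R -> R,
     copula_of (X 0%N) (X 1%N) (density_cdf f) (density_cdf f) C ->
     forall u v : R, 0 <= u <= 1 -> 0 <= v <= 1 ->
       C u v = mh_AC f q u v + mh_SC f q u v).
Proof.
have cop := mh_is_copula mD mf f_gt0 f_out mq q_gt0 q_int1 hX.
have joint := mh_copula_joint mD mf f_gt0 f_out mq q_gt0 q_int1 hX.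
split; first by split.
move=> C [copC jointC] u v u01 v01.
have [c1 c2 c3 c4] := copula_margins copC u01.
have [c1' c2' c3' c4'] := copula_margins copC v01.
have [e1 e2 e3 e4] := copula_margins cop u01.
have [e1' e2' e3' e4'] := copula_margins cop v01.
(* The four sides of the square, where both copulas have prescribed values. *)
have [|u0] := eqVneq u 0; first by move=> ->; rewrite c1' e1'.
have [|v0] := eqVneq v 0; first by move=> ->; rewrite c2 e2.
have [|u1] := eqVneq u 1; first by move=> ->; rewrite c3' e3'.
have [|v1] := eqVneq v 1; first by move=> ->; rewrite c4 e4.
have u01' : 0 < u < 1 by rewrite !lt_neqAle eq_sym u0 u1.
have v01' : 0 < v < 1 by rewrite !lt_neqAle eq_sym v0 v1.
have FQ := chain_cdf_quantile hX.
by apply: EFin_inj; rewrite -(FQ u u01') -(FQ v v01') -jointC joint.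
Qed.
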